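(* Let $C_1,\ldots,C_N\subset\mathbb{R}^d$ be closed convex sets with nonempty intersection $C=C_1\cap\cdots\cap C_N$. Let $(\beta^{(n)})_{n\ge1}$ be a sequence in $\mathcal{B}$, $\beta^{(n)}=(\beta^{(n)}_1,\ldots,\beta^{(n)}_N)$, let $I^{(n)}=\{i:1\le i\le N,\ \beta^{(n)}_i>0\}$ be the set of active indices for $\beta^{(n)}$, and let $J^{(n)}\subset I^{(n)}$, $n\ge1$, be a sequence of subsets such that $$\sum_{n=1}^\infty\ \sum_{i\in I^{(n)}\setminus J^{(n)}}\beta_i^{(n)}<+\infty.$$ Assume that every index $i\in\{1,2,\ldots,N\}$ occurs in $J^{(n)}$ for infinitely many $n$. Let $0\le n_0<n_1<n_2<\cdots$ be integers such that for every $k\ge1$ $$\{1,2,\ldots,N\}\subset J^{(n_{k-1}+1)}\cup J^{(n_{k-1}+2)}\cup\cdots\cup J^{(n_k)},$$ i.e. every index occurs at least once for $n$ such that $n_{k-1}<n\le n_k$. For $n\ge1$ and $i\in I^{(n)}$ put $$\nu_i^{(n)}=\frac{2\beta_i^{(n)}\left(2-\sum_{l=1}^N\beta_l^{(n)}\right)}{\beta_i^{(n)}+2-\sum_{l=1}^N\beta_l^{(n)}},$$ and for $k\ge1$ let $$\nu_J^{(k)}=\min\{\nu_i^{(n)} : n_{k-1}<n\le n_k,\ i\in J^{(n)}\}.$$ Assume that $$\sum_{k=1}^\infty\nu_J^{(k)}=+\infty.$$ Then for any $x^{(0)}\in\mathbb{R}^d$ the sequence $x^{(n)}$ defined by $$x^{(n)}=Q_{\beta^{(n)}}(x^{(n-1)}),\qquad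 n\ge1,$$ is convergent to a point in $C$.
   Context: For a nonempty closed convex set $D\subset\mathbb{R}^d$ (with Euclidean norm), $P_D$ is the (nearest point) projection onto $D$. The parameter set is $\mathcal{B}=\{\beta=(\beta_1,\ldots,\beta_N): \beta_i\ge 0 \text{ for all } i,\ \sum_{i=1}^N\beta_i\le 2\}$. For $\beta\in\mathcal{B}$ the operator $Q_\beta:\mathbb{R}^d\to\mathbb{R}^d$ is $Q_\beta=\mathrm{Id}-\sum_{j=1}^N\beta_j(\mathrm{Id}-P_{C_j})$, where $\mathrm{Id}$ is the identity. *)

(* Defs.v *)
From mathcomp Require Import all_boot all_order all_algebra.
From mathcomp Require Import all_classical all_reals all_analysis.
Set Implicit Arguments.
Unset Strict Implicit.
Unset Printing Implicit Defensive.
Import Order.TTheory GRing.Theory Num.Theory.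
Import numFieldNormedType.Exports.
Local Open Scope classical_set_scope.
Local Open Scope ring_scope.

(* The library's norm on ['rV[R]_d] is the sup norm, hence this definition; the
   two norms induce the same topology, so [closed] and [-->] are the usual ones. *)
Definition euclidean_norm (R : realType) (d : nat) (v : 'rV[R]_d) : R :=
  Num.sqrt (\sum_(i < d) v 0 i ^+ 2).

Definition nearest_points (R : realType) (d : nat) (D : set 'rV[R]_d)
    (x : 'rV[R]_d) : set 'rV[R]_d :=
  [set y | D y /\
    forall z, D z -> euclidean_norm (x - y) <= euclidean_norm (x - z)].

(* Total by choice, with junk value 0 when there is no nearest point; for D
   nonempty, closed and convex the nearest point exists and is unique. *)
Definition proj (R : realType) (d : nat) (D : set 'rV[R]_d)
    (x : 'rV[R]_d) : 'rV[R]_d :=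
  xget 0 (nearest_points D x).

Definition weights (R : realType) (N : nat) : set ('I_N -> R) :=
  [set b | (forall i, 0 <= b i) /\ \sum_(i < N) b i <= 2].

Definition Q (R : realType) (d N : nat) (C : 'I_N -> set 'rV[R]_d)
    (b : 'I_N -> R) (x : 'rV[R]_d) : 'rV[R]_d :=
  x - \sum_(j < N) b j *: (x - proj (C j) x).

Definition active (R : realType) (N : nat) (b : 'I_N -> R) : {set 'I_N} :=
  [set i | 0 < b i]%SET.

Definition nu (R : realType) (N : nat) (b : 'I_N -> R) (i : 'I_N) : R :=
  let s := 2 - \sum_(l < N) b l in 2 * b i * s / (b i + s).

(* The least element of A, with junk value 0 when A has none. *)
Definition set_min (R : realType) (A : set R) : R :=
  xget 0 [set m | A m /\ lbound A m].

Definition nuJ (R : realType) (N : nat) (beta : nat -> 'I_N -> R)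
    (J : nat -> {set 'I_N}) (nn : nat -> nat) (k : nat) : R :=
  set_min [set r | exists n i,
    [/\ (nn k.-1 < n <= nn k)%N, i \in J n & r = nu (beta n) i]].

(* Main.v *)
(* For [c] in the intersection and an active index [i], the step satisfies
   [|Q x - c|^2 <= |x - c|^2 - nu_i |x - P_i x|^2]. Hence the iterates are Fejer
   monotone, and since the [nu_J] sum to infinity there are arbitrarily late
   blocks on which all the distances to [C_i] measured at the times when [i] is
   in [J] are arbitrarily small. Let [p] be a cluster point of the starting
   points of such blocks. If [p] missed some [C_i], then as long as the iterates
   of such a block stay near [p], only indices [j] with [p] in [C_j] can belong
   to [J]; the corresponding steps are Fejer with respect to [p], up to the
   summable contribution of the indices outside [J], so the iterates do stay
   near [p] during the whole block, and [i] never occurs in [J], against the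
   covering assumption. So [p] is in the intersection, and Fejer monotonicity
   with respect to [p] turns subsequential convergence into convergence. *)
Require Import Defs.
From mathcomp Require Import all_boot all_order all_algebra.
From mathcomp Require Import all_classical all_reals all_analysis.
From mathcomp Require Import ring lra.
Import Order.TTheory GRing.Theory Num.Theory.
Set Implicit Arguments.
Unset Strict Implicit.
Unset Printing Implicit Defensive.
Import numFieldNormedType.Exports.
Local Open Scope classical_set_scope.
Local Open Scope ring_scope.

Local Notation norm2 := euclidean_norm.
(* [mathcomp_extra] exports an unrelated [proj]. *)
Local Notation proj := Defs.proj.

(** * Euclidean inner product and norm, compared with the sup norm *)

Definition dot (R : realType) (d : nat) (u v : 'rV[R]_d) : R :=
  \sum_(i < d) u 0 i * v 0 i.

Section Euclidean.
Context {R : realType} {d : nat}.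
Implicit Types (u v w : 'rV[R]_d) (a : R).

Lemma dotC u v : dot u v = dot v u.
Proof. by apply: eq_bigr => i _; rewrite mulrC. Qed.

Lemma dotDl u v w : dot (u + v) w = dot u w + dot v w.
Proof. by rewrite -big_split; apply: eq_bigr => i _; rewrite mxE mulrDl. Qed.

Lemma dotZl a u v : dot (a *: u) v = a * dot u v.
Proof. by rewrite mulr_sumr; apply: eq_bigr => i _; rewrite mxE mulrA. Qed.

Lemma dotNl u v : dot (- u) v = - dot u v.
Proof. by rewrite -scaleN1r dotZl mulN1r. Qed.

Lemma dotDr u v w : dot w (u + v) = dot w u + dot w v.
Proof. by rewrite dotC dotDl !(dotC w). Qed.

Lemma dotZr a u v : dot u (a *: v) = a * dot u v.
Proof. by rewrite dotC dotZl dotC. Qed.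

Lemma dotNr u v : dot u (- v) = - dot u v.
Proof. by rewrite dotC dotNl dotC. Qed.

Definition dotE := (dotDl, dotDr, dotNl, dotNr, dotZl, dotZr).

Lemma dot0l u : dot 0 u = 0.
Proof. by apply: big1 => i _; rewrite mxE mul0r. Qed.

Lemma dotBZ a u v :
  dot (u - a *: v) (u - a *: v) = dot u u - 2 * a * dot u v + a ^+ 2 * dot v v.
Proof. by rewrite !dotE (dotC v u); ring. Qed.

Lemma dotZD a u v :
  dot (a *: u + v) (a *: u + v) = a ^+ 2 * dot u u + 2 * a * dot v u + dot v v.
Proof. by rewrite !dotE (dotC v u); ring. Qed.

Lemma dot_suml (I : Type) (r : seq I) (P : pred I) (F : I -> 'rV[R]_d) v :
  dot (\sum_(i <- r | P i) F i) v = \sum_(i <- r | P i) dot (F i) v.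
Proof.
by elim/big_rec2: _ => [|i y z _ <-]; rewrite ?dot0l// dotDl.
Qed.

Lemma dot_ge0 u : 0 <= dot u u.
Proof. by apply: sumr_ge0 => i _; rewrite -expr2 sqr_ge0. Qed.

Lemma euclidean_norm_sqr u : norm2 u ^+ 2 = dot u u.
Proof.
rewrite sqr_sqrtr; last by apply: sumr_ge0 => i _; exact: sqr_ge0.
by apply: eq_bigr => i _; rewrite expr2.
Qed.

Lemma euclidean_norm_ge0 u : 0 <= norm2 u.
Proof. exact: sqrtr_ge0. Qed.

Lemma ler_euclidean_norm u v : (norm2 u <= norm2 v) = (dot u u <= dot v v).
Proof.
by rewrite -!euclidean_norm_sqr ler_sqr // nnegrE euclidean_norm_ge0.
Qed.

Lemma euclidean_norm0 : norm2 (0 : 'rV[R]_d) = 0.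
Proof. by apply/eqP; rewrite -sqrf_eq0 euclidean_norm_sqr dot0l. Qed.

Lemma euclidean_normZ a u : norm2 (a *: u) = `|a| * norm2 u.
Proof.
apply/eqP; rewrite -(eqrXn2 (n := 2)) ?mulr_ge0 ?euclidean_norm_ge0 //.
by rewrite exprMn !euclidean_norm_sqr !dotE real_normK ?num_real // expr2 mulrA.
Qed.

Lemma euclidean_normN u : norm2 (- u) = norm2 u.
Proof. by rewrite -scaleN1r euclidean_normZ normrN1 mul1r. Qed.

Lemma euclidean_normB u v : norm2 (u - v) = norm2 (v - u).
Proof. by rewrite -opprB euclidean_normN. Qed.

Lemma coord_le_euclidean_norm u i : `|u 0 i| <= norm2 u.
Proof.
rewrite -sqrtr_sqr ler_sqrt; last by apply: sumr_ge0 => j _; exact: sqr_ge0.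
by rewrite (bigD1 i) //= lerDl sumr_ge0 // => j _; exact: sqr_ge0.
Qed.

Lemma norm_le_euclidean_norm u : `|u| <= norm2 u.
Proof.
rewrite [leLHS]/Num.Def.normr/= mx_normrE bigmax_le ?euclidean_norm_ge0 //.
by case=> i j _ /=; rewrite ord1 coord_le_euclidean_norm.
Qed.

Lemma dot_le_norm u v : dot u v <= norm2 u * norm2 v.
Proof.
have [v0|v0] := eqVneq (norm2 v) 0.
  suff -> : v = 0 by rewrite dotC dot0l mulr_ge0 ?euclidean_norm_ge0.
  by apply/normr0_eq0/le_anti; rewrite normr_ge0 -v0 norm_le_euclidean_norm.
have {}v0 : 0 < norm2 v by rewrite lt_neqAle eq_sym v0 euclidean_norm_ge0.
apply: le_trans (ler_norm _) _.
rewrite -ler_sqr ?nnegrE ?mulr_ge0 ?euclidean_norm_ge0 //.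
rewrite real_normK ?num_real // exprMn !euclidean_norm_sqr.
have v1 : 0 < dot v v by rewrite -euclidean_norm_sqr exprn_gt0.
(* Expanding gives [|v|^2 (|u|^2 |v|^2 - <u,v>^2) >= 0]; the factor [|v|^2] is then cancelled. *)
have := dot_ge0 (dot v v *: u - dot u v *: v); rewrite !dotE (dotC v u) => H.
by rewrite -(ler_pM2l v1); lra.
Qed.

Lemma euclidean_norm_triangle u v : norm2 (u + v) <= norm2 u + norm2 v.
Proof.
rewrite -ler_sqr ?nnegrE ?addr_ge0 ?euclidean_norm_ge0 //.
rewrite sqrrD !euclidean_norm_sqr !dotE (dotC v u).
by have := dot_le_norm u v; lra.
Qed.

Lemma euclidean_dist_triangle u v w :
  norm2 (u - w) <= norm2 (u - v) + norm2 (v - w).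
Proof. by rewrite -(subrKA v) euclidean_norm_triangle. Qed.

Lemma euclidean_norm_sum (I : Type) (r : seq I) (P : pred I)
    (F : I -> 'rV[R]_d) :
  norm2 (\sum_(i <- r | P i) F i) <= \sum_(i <- r | P i) norm2 (F i).
Proof.
elim/big_ind2: _ => [|u a v b ua vb|//]; first by rewrite euclidean_norm0.
by apply: le_trans (euclidean_norm_triangle _ _) _; exact: lerD.
Qed.

Lemma euclidean_norm_le_norm u : norm2 u <= d%:R * `|u|.
Proof.
rewrite {1}[u]row_sum_delta; apply: le_trans (euclidean_norm_sum _ _ _) _.
rewrite -[d in d%:R]card_ord -sumr_const mulr_suml; apply: ler_sum => i _.
rewrite mul1r euclidean_normZ.
have -> : norm2 (delta_mx 0 i : 'rV[R]_d) = 1.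
  rewrite /euclidean_norm (bigD1 i) //= mxE !eqxx big1 ?addr0 ?expr1n ?sqrtr1//.
  by move=> j /negPf ji; rewrite mxE ji andbF expr0n.
rewrite mulr1 [leRHS]/Num.Def.normr/= mx_normrE.
exact: (le_bigmax _ (fun ij => `|u ij.1 ij.2|) (0, i)).
Qed.

(** * Closedness and compactness in terms of the Euclidean norm *)

Lemma closed_far {D : set 'rV[R]_d} {p : 'rV[R]_d} : closed D -> ~ D p ->
  exists2 e : R, 0 < e & forall y, D y -> e <= norm2 (p - y).
Proof.
move=> cD Dp; have /nbhs_ballP[e e0 pe] : nbhs p (~` D).
  by apply: open_nbhs_nbhs; split => //; exact: closed_openC.
exists e => // y Dy; rewrite leNgt; apply/negP => ye.
apply: (pe y) => //; rewrite -ball_normE /=.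
exact: le_lt_trans (norm_le_euclidean_norm _) _.
Qed.

(** Bolzano-Weierstrass, phrased as frequent closeness to [p] instead of through a subsequence: a
    Euclidean bound confines the sequence to a compact sup-norm ball. *)
Lemma bounded_cluster {y : nat -> 'rV[R]_d} {c : 'rV[R]_d} {M : R} :
  (forall n, norm2 (y n - c) <= M) ->
  exists p : 'rV[R]_d, forall (e : R) m, 0 < e ->
    exists2 n, (m <= n)%N & norm2 (y n - p) < e.
Proof.
move=> yM; set A := closed_ball c (M + 1).
have M0 : 0 < M + 1.
  by rewrite ltr_wpDl //; exact: le_trans (euclidean_norm_ge0 _) (yM 0).
have cA : compact A.
  apply: bounded_closed_compact; last exact: closed_ball_closed.
  exists (`|c| + (M + 1)); split; first exact: num_real.
  move=> r rM u; rewrite /A closed_ballE //= /closed_ball_ /= => uc.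
  rewrite -(subKr c u) (le_trans (ler_normB _ _)) //.
  by rewrite (le_trans _ (ltW rM)) // lerD2l.
have yA : (y @ \oo) A.
  exists 0%N => // n _ /=; rewrite /A closed_ballE //= /closed_ball_ /=.
  rewrite distrC (le_trans (norm_le_euclidean_norm _)) //.
  by rewrite (le_trans (yM n)) // lerDl.
have [p [_ py]] := cA (y @ \oo) _ yA.
exists p => e m e0.
(* The Euclidean norm is at most [d] times the sup norm; [d.+1] also covers [d = 0]. *)
have d0 : 0 < e / d.+1%:R by rewrite divr_gt0.
have [||q [[n /= mn <-]]] := py [set y n | n in [set n | (m <= n)%N]]
    (ball p (e / d.+1%:R)).
- by exists m => // n mn; exists n.
- exact: nbhsx_ballx.
rewrite -ball_normE /= distrC ltr_pdivlMr // => yp.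
exists n => //.
apply: le_lt_trans (euclidean_norm_le_norm _) (le_lt_trans _ yp).
by rewrite mulrC ler_wpM2l // ler_nat.
Qed.

(** * Nearest points and the projection *)

Lemma nearest_point_exists {D : set 'rV[R]_d} (x : 'rV[R]_d) :
  closed D -> D !=set0 -> exists y, nearest_points D x y.
Proof.
move=> cD [z0 Dz0].
pose S := [set norm2 (x - z) | z in D].
have Sinf : has_inf S.
  split; first by exists (norm2 (x - z0)); exists z0.
  by exists 0 => _ [z _ <-]; exact: euclidean_norm_ge0.
(* A minimizing sequence; its cluster point will be the nearest point. *)
have Hy n : exists z, D z /\ norm2 (x - z) < inf S + n.+1%:R^-1.
  have n0 : (0 : R) < n.+1%:R^-1 by rewrite invr_gt0.
  by have [_ [z Dz <-] zS] := inf_adherent n0 Sinf; exists z.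
have [y yP] := choice Hy.
have [n|p py] := @bounded_cluster y x (inf S + 1).
  rewrite euclidean_normB (le_trans (ltW (yP n).2)) // lerD2l.
  by rewrite invf_le1 // ler1n.
exists p; split.
  apply: contrapT => Dp; have [e e0 pe] := closed_far cD Dp.
  have [n _] := py e 0 e0; apply/negP; rewrite -leNgt euclidean_normB.
  exact/pe/(yP n).1.
move=> z Dz; suff : norm2 (x - p) <= inf S.
  by move=> /le_trans; apply; apply: ge_inf; [case: Sinf|exists z].
rewrite leNgt; apply/negP; rewrite -subr_gt0; set e : R := _ - _ => e0.
have e2 : 0 < e / 2 by rewrite divr_gt0.
have [m _ mP] := near_infty_natSinv_lt (PosNum e2).
have [n mn yn] := py _ m e2.
have := euclidean_dist_triangle x (y n) p.
have me : (n.+1%:R^-1 : R) < e / 2 by exact: mP.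
have := (yP n).2; move: yn me; rewrite /e; move: (n.+1%:R^-1) => r; lra.
Qed.

Lemma proj_nearest {D : set 'rV[R]_d} {c : 'rV[R]_d} (x : 'rV[R]_d) :
  closed D -> D c -> nearest_points D x (proj D x).
Proof.
move=> cD Dc; apply: xgetPex.
by apply: nearest_point_exists => //; exists c.
Qed.

(** By convexity the segment from the projection towards [c] stays in [D], and it cannot come closer
    to [x]; this excludes an acute angle. *)
Lemma proj_obtuse {D : set 'rV[R]_d} {c : 'rV[R]_d} (x : 'rV[R]_d) :
  closed D -> convex_set D -> D c -> dot (x - proj D x) (c - proj D x) <= 0.
Proof.
move=> cD convD Dc; have [Dy ymin] := proj_nearest x cD Dc.
set y := proj D x in Dy ymin *.
rewrite leNgt; apply/negP => a0; set a := dot _ _ in a0.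
pose b := dot (c - y) (c - y); have b0 : 0 <= b by exact: dot_ge0.
have ab0 : 0 < a + b by rewrite ltr_wpDr.
(* Minimality at step [t] gives [2 a <= t b]; with this [t] it reads [2 a (a + b) <= a b],
   impossible for [a > 0], [b >= 0]. *)
pose t := a / (a + b).
have t0 : 0 <= t by rewrite divr_ge0 ?ltW.
have t1 : t <= 1 by rewrite ler_pdivrMr // mul1r lerDl.
have tD : D (y + t *: (c - y)).
  have := convD c y (Itv01 t0 t1) (mem_set Dc) (mem_set Dy).
  rewrite inE; congr (D _).
  by rewrite /conv /= scalerBr scalerBl scale1r addrCA.
have := ymin _ tD; rewrite ler_euclidean_norm opprD addrA dotBZ -/a -/b => H.
have {}H : t * (2 * a) <= t * (t * b) by lra.
have tp : 0 < t by rewrite divr_gt0.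
move: H; rewrite ler_pM2l // /t mulrAC ler_pdivlMr //.
by have := mulr_ge0 (ltW a0) b0; have := mulr_gt0 a0 a0; lra.
Qed.

Lemma proj_dot {D : set 'rV[R]_d} {c : 'rV[R]_d} (x : 'rV[R]_d) :
  closed D -> convex_set D -> D c ->
  dot (x - proj D x) (x - proj D x) <= dot (x - proj D x) (x - c).
Proof.
move=> cD convD Dc; rewrite -[x - c](subrKA (proj D x)) [leRHS]dotDr lerDl.
by rewrite -[_ - c]opprB dotNr oppr_ge0 proj_obtuse.
Qed.

End Euclidean.

(** * Identities and inequalities for weighted sums of vectors *)

Section WeightedSums.
Context {R : realType} {d : nat} {I : finType}.
Implicit Types (b : I -> R) (F : I -> 'rV[R]_d) (P : pred I).

(** Nonnegativity of the left side is used twice: with [v] the weighted sum it gives the Jensen-type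
    bound below, and with [v] a single displacement it gives the constant [nu]. *)
Lemma weighted_sum_dotB b F P (h a : R) (v : 'rV[R]_d) :
  \sum_(j | P j) b j * dot (h *: F j - a *: v) (h *: F j - a *: v) =
  h ^+ 2 * (\sum_(j | P j) b j * dot (F j) (F j))
  - 2 * h * a * dot (\sum_(j | P j) b j *: F j) v
  + a ^+ 2 * (\sum_(j | P j) b j) * dot v v.
Proof.
rewrite dot_suml [a ^+ 2 * _ * _]mulrAC.
under eq_bigr => j _ do rewrite dotBZ !dotE.
under [X in _ = _ - _ * X + _]eq_bigr => j _ do rewrite dotZl.
move: (dot v v) => V; rewrite !mulr_sumr -sumrB -big_split /=.
by apply: eq_bigr => j _; ring.
Qed.

Lemma dot_weighted_sum_le b F P : (forall j, 0 <= b j) ->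
  dot (\sum_(j | P j) b j *: F j) (\sum_(j | P j) b j *: F j) <=
  (\sum_(j | P j) b j) * (\sum_(j | P j) b j * dot (F j) (F j)).
Proof.
move=> b0; set w := \sum_(j | P j) b j *: F j.
set t := \sum_(j | P j) b j.
have [t0|t0] := eqVneq t 0.
  suff -> : w = 0 by rewrite t0 mul0r dot0l.
  apply: big1 => j Pj; suff -> : b j = 0 by rewrite scale0r.
  by apply: (psumr_eq0P _ t0) => // i _.
have {}t0 : 0 < t by rewrite lt_neqAle eq_sym t0 sumr_ge0.
have := weighted_sum_dotB b F P t 1 w; rewrite -/w -/t => e.
have : 0 <= \sum_(j | P j) b j * dot (t *: F j - 1 *: w) (t *: F j - 1 *: w).
  by apply: sumr_ge0 => j _; rewrite mulr_ge0 ?dot_ge0.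
by rewrite e => H; rewrite -(ler_pM2l t0); lra.
Qed.

End WeightedSums.

(** * One application of [Q] *)

Section Operator.
Context {R : realType} {d N : nat} {C : 'I_N -> set 'rV[R]_d}.
Hypothesis C_closed : forall i, closed (C i).
Hypothesis C_convex : forall i, convex_set (C i).
Implicit Types (b : 'I_N -> R) (x c : 'rV[R]_d).

(** Expand the square and bound the cross terms by [proj_dot]. Only sets of positive weight have to
    contain [c], so that the bound also serves for a cluster point not yet known to lie in every
    [C i]. *)
Lemma Q_dot_le b x c : (forall j, 0 <= b j) -> (forall j, 0 < b j -> C j c) ->
  dot (Q C b x - c) (Q C b x - c) <= dot (x - c) (x - c)
  - 2 * (\sum_j b j * dot (x - proj (C j) x) (x - proj (C j) x))
  + dot (\sum_j b j *: (x - proj (C j) x)) (\sum_j b j *: (x - proj (C j) x)).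
Proof.
move=> b0 bC; rewrite /Q; set w := \sum_j _ *: _.
have -> : x - w - c = x - c - 1 *: w by rewrite scale1r addrAC.
rewrite dotBZ expr1n mul1r mulr1 lerD2r lerD2l lerN2 ler_pM2l // dotC dot_suml.
apply: ler_sum => j _; rewrite dotZl.
have [bj|bj] := ltP 0 (b j).
  by apply: ler_wpM2l => //; apply: proj_dot => //; exact: bC.
have -> : b j = 0 by apply/le_anti; rewrite bj b0.
by rewrite !mul0r.
Qed.

(** The squared norm of the total displacement is at most the total weight times the weighted sum of
    squares; as that weight is at most 2, the negative term absorbs it. *)
Lemma Q_fejer b x c : weights b -> (forall j, 0 < b j -> C j c) ->
  norm2 (Q C b x - c) <= norm2 (x - c).
Proof.
move=> [b0 b2] bC; rewrite ler_euclidean_norm.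
apply: le_trans (Q_dot_le x b0 bC) _.
have := dot_weighted_sum_le (fun j => x - proj (C j) x) xpredT b0 => /= H.
rewrite -addrA gerDl addrC subr_le0; apply: le_trans H _.
by rewrite ler_wpM2r // sumr_ge0 // => j _; rewrite mulr_ge0 ?dot_ge0.
Qed.

Lemma Q_decrease b x c i : weights b -> (forall j, C j c) -> 0 < b i ->
  dot (Q C b x - c) (Q C b x - c) <= dot (x - c) (x - c)
    - nu b i * dot (x - proj (C i) x) (x - proj (C i) x).
Proof.
move=> [b0 b2] Cc bi; apply: le_trans (Q_dot_le x b0 _) _ => //.
pose F j := x - proj (C j) x.
rewrite -addrA lerD2l /nu.
rewrite !(bigD1 i (P := xpredT)) //= in b2 *.
rewrite -/(F i); set D := dot (F i) (F i).
set t := \sum_(j | j != i) b j in b2 *.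
set g := \sum_(j | j != i) b j * _; set w := \sum_(j | j != i) _ *: _.
have ww : dot w w <= t * g by exact: dot_weighted_sum_le.
(* [h] is the denominator of [nu b i]. After multiplication by [h] the terms in [g] cancel because
   [h + t = 2]. *)
set h := 2 - t; have h0 : 0 < h by rewrite /h; lra.
(* The constant [nu_i] is what [sum_(j != i) b_j |h F_j - b_i F_i|^2 >= 0]
   gives. *)
have := weighted_sum_dotB b F (fun j => j != i) h (b i) (F i).
rewrite -/t -/w -/g -/D => e.
have {e} : 0 <= h ^+ 2 * g - 2 * h * b i * dot w (F i) + b i ^+ 2 * t * D.
  by rewrite -e; apply: sumr_ge0 => j _; rewrite mulr_ge0 ?dot_ge0.
rewrite dotZD -/D => H.
have -> : b i + (2 - (b i + t)) = h by rewrite /h; ring.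
rewrite -(ler_pM2l h0) [leRHS]mulrN mulrA.
have -> : h * (2 * b i * (2 - (b i + t)) / h) = 2 * b i * (2 - (b i + t)).
  by rewrite mulrC divfK // gt_eqF.
have {ww} := ler_wpM2l (ltW h0) ww.
move: (dot w w) (dot w (F i)) H => W W' H; move: H; rewrite /h; lra.
Qed.

End Operator.

(** * Nonnegative series, and the minimum [nuJ] *)

Lemma pinfty_series_unbounded (R : realType) (a : nat -> R) (n : nat) (M : R) :
  (forall k, (1 <= k)%N -> 0 <= a k) -> (\sum_(1 <= k <oo) (a k)%:E = +oo)%E ->
  exists m, M < \sum_(n.+1 <= k < n.+1 + m) a k.
Proof.
move=> a0 aoo; apply: contrapT => /forallNP aM.
suff : (\sum_(1 <= k <oo) (a k)%:E <= (\sum_(1 <= k < n.+1) a k + M)%:E)%E.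
  by rewrite aoo leye_eq.
apply: lime_le.
  by apply: is_cvg_nneseries => k k1 _; rewrite lee_fin a0.
exists n.+1 => // m /= nm; rewrite sumEFin lee_fin.
rewrite (big_cat_nat (n := n.+1)) //= lerD2l leNgt; apply/negP.
by have := aM (m - n.+1)%N; rewrite subnKC.
Qed.

(** Once a partial sum is within [e] of the supremum of all of them, no later stretch of terms can
    add up to [e]. *)
Lemma nneg_series_small_tail (R : realType) (a : nat -> R) (e : R) :
  (forall k, (1 <= k)%N -> 0 <= a k) -> (\sum_(1 <= k <oo) (a k)%:E < +oo)%E ->
  0 < e -> exists n, forall m p, (n <= m <= p)%N ->
    \sum_(m.+1 <= k < p.+1) a k < e.
Proof.
move=> a0 aoo e0; pose T n := \sum_(1 <= k < n.+1) a k.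
have aE k : (1 <= k)%N -> (0 <= (a k)%:E)%E by move=> k1; rewrite lee_fin a0.
have Tsup : has_sup (range T).
  split; first by exists (T 0); exists 0%N.
  exists (fine (\sum_(1 <= k <oo) (a k)%:E)) => _ [n _ <-].
  rewrite -lee_fin fineK; last first.
    by rewrite ge0_fin_numE //; apply: nneseries_ge0 => k k1 _; exact: aE.
  by rewrite /T -sumEFin; apply: nneseries_lim_ge => k k1 _; exact: aE.
have [_ [n _ <-] Tn] := sup_adherent e0 Tsup.
exists n => m p /andP[nm mp].
have Tcat i j : (i <= j)%N -> T j = T i + \sum_(i.+1 <= k < j.+1) a k.
  by move=> ij; rewrite /T (big_cat_nat (n := i.+1)).
have := Tcat _ _ mp; have := Tcat _ _ nm.
have : 0 <= \sum_(n.+1 <= k < m.+1) a k.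
  rewrite big_nat_cond; apply: sumr_ge0 => k /andP[/andP[nk _] _].
  by rewrite a0 // (leq_trans _ nk).
have : T p <= sup (range T) by apply: sup_upper_bound => //; exists p.
by move: (T n) (T m) (T p) (sup _) Tn => t1 t2 t3 t4; lra.
Qed.

Lemma set_minP (R : realType) (A : set R) :
  (exists m, A m /\ lbound A m) -> A (set_min A) /\ lbound A (set_min A).
Proof. by move=> Am; have := xgetPex 0 Am. Qed.

(** Rules out the junk value of [set_min]: the pairs [(n, i)] of a block form a finite set, here
    nonempty, so the minimum is attained. *)
Lemma nuJ_min (R : realType) (N : nat) (beta : nat -> 'I_N -> R)
    (J : nat -> {set 'I_N}) (nn : nat -> nat) k n i :
  (nn k.-1 < n <= nn k)%N -> i \in J n ->
  (exists m j, [/\ (nn k.-1 < m <= nn k)%N, j \in J m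
     & nuJ beta J nn k = nu (beta m) j]) /\
  nuJ beta J nn k <= nu (beta n) i.
Proof.
move=> kn iJ; rewrite /nuJ; set A := [set r | _].
suff /set_minP[[m [j [km jJ ->]]] lb] : exists m, A m /\ lbound A m.
  by split; [exists m, j|apply: lb; exists n, i].
pose P (q : 'I_(nn k).+1 * 'I_N) := (nn k.-1 < q.1)%N && (q.2 \in J q.1).
have nk : (n < (nn k).+1)%N by rewrite ltnS; case/andP: kn.
have P0 : P (Ordinal nk, i) by rewrite /P /= iJ andbT; case/andP: kn.
have [[m j] /andP[/= km jJ] mmin] :=
  @arg_minP _ _ _ (Ordinal nk, i) P (fun q => nu (beta q.1) q.2) P0.
exists (nu (beta m) j); split.
  by exists m, j; split => //; rewrite km -ltnS /=.
move=> _ [m' [j' [/andP[km' mk'] j'J ->]]].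
have m'k : (m' < (nn k).+1)%N by rewrite ltnS.
by apply: (mmin (Ordinal m'k, j')); rewrite /P /= km' j'J.
Qed.

Lemma nu_ge0 (R : realType) (N : nat) (b : 'I_N -> R) i :
  weights b -> 0 <= nu b i.
Proof.
move=> [b0 b2]; rewrite /nu.
have s0 : 0 <= 2 - \sum_(l < N) b l by rewrite subr_ge0.
by apply: divr_ge0; [rewrite !mulr_ge0|exact: addr_ge0].
Qed.

(** * The iterates: monotonicity, good blocks, convergence *)

Section Iteration.
Context {R : realType} {d N : nat} {C : 'I_N -> set 'rV[R]_d}.
Context {beta : nat -> 'I_N -> R} {J : nat -> {set 'I_N}} {nn : nat -> nat}.
Context {x : nat -> 'rV[R]_d}.
Hypothesis C_closed : forall i, closed (C i).
Hypothesis C_convex : forall i, convex_set (C i).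
Hypothesis beta_weights : forall n, (1 <= n)%N -> weights (beta n).
Hypothesis x_rec : forall n, (1 <= n)%N -> x n = Q C (beta n) (x n.-1).

Lemma iterates_fejer c m n : (forall i, C i c) -> (m <= n)%N ->
  norm2 (x n - c) <= norm2 (x m - c).
Proof.
move=> Cc /subnK <-; elim: (n - m)%N => // k IH.
rewrite addSn x_rec //=; apply: le_trans IH.
by apply: Q_fejer => //; exact: beta_weights.
Qed.

Let inactive_weight n := \sum_(i in active (beta n) :\: J n) beta n i.

(** With the weights outside [J] set to 0, the step is Fejer with respect to [p]. The part removed
    is a perturbation whose displacements have norm at most [|x n - c| <= |x 0 - c|]. *)
Lemma iterates_quasi_fejer c p n : (forall i, C i c) ->
  (forall i, i \in J n.+1 -> C i p) ->
  norm2 (x n.+1 - p) <=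
    norm2 (x n - p) + inactive_weight n.+1 * norm2 (x 0 - c).
Proof.
move=> Cc Jp; rewrite x_rec //=.
have [b0 b2] := beta_weights (ltn0Sn n).
set b := beta n.+1 in b0 b2 *; set A := active b :\: J n.+1.
pose b' j := if j \in A then 0 else b j.
pose e := \sum_(j in A) b j *: (x n - proj (C j) (x n)).
have -> : Q C b (x n) - p = (Q C b' (x n) - p) - e.
  rewrite /Q /e [\sum_j b j *: _](bigID (fun j => j \in A)) /=.
  rewrite [\sum_j b' j *: _](bigID (fun j => j \in A)) /=.
  rewrite [X in _ = _ - (X + _) - p - _]big1 ?add0r; last first.
    by move=> j jA; rewrite /b' jA scale0r.
  rewrite [X in _ = _ - X - p - _](_ : _ =
    \sum_(j | j \notin A) b j *: (x n - proj (C j) (x n))).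
    by rewrite opprD -!addrA; congr (_ + _); rewrite [LHS]addrC addrA.
  by apply: eq_bigr => j /negPf jA; rewrite /b' jA.
apply: le_trans (euclidean_norm_triangle _ _) _; rewrite euclidean_normN.
apply: lerD.
  apply: Q_fejer => //.
    split=> [j|]; first by rewrite /b'; case: ifP.
    by apply: le_trans b2; apply: ler_sum => j _; rewrite /b'; case: ifP.
  move=> j; rewrite /b' !inE; case: ifP => [_|]; first by rewrite ltxx.
  by move=> jA bj; apply: Jp; move: jA; rewrite bj andbT => /negbFE.
apply: le_trans (euclidean_norm_sum _ _ _) _; rewrite mulr_suml.
apply: ler_sum => j _; rewrite euclidean_normZ ger0_norm // ler_wpM2l //.
apply: le_trans (iterates_fejer Cc (leq0n n)).
by have [_] := proj_nearest (x n) (@C_closed j) (Cc j); exact.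
Qed.

(** Step [n] alone yields the gain; the other steps of the block do not increase the distance to
    [c]. *)
Lemma iterates_block_decrease c k n i : (forall j, C j c) ->
  (nn k.-1 < n <= nn k)%N -> 0 < beta n i ->
  dot (x (nn k) - c) (x (nn k) - c) <=
    dot (x (nn k.-1) - c) (x (nn k.-1) - c) - nu (beta n) i *
      dot (x n.-1 - proj (C i) (x n.-1)) (x n.-1 - proj (C i) (x n.-1)).
Proof.
move=> Cc /andP[kn nk] bi.
have n0 : (0 < n)%N by apply: leq_trans kn.
have := iterates_fejer Cc nk; rewrite ler_euclidean_norm => /le_trans; apply.
rewrite {1 2}(x_rec n0).
apply: le_trans
  (Q_decrease C_closed C_convex _ (beta_weights n0) Cc bi) _.
by rewrite lerD2r -ler_euclidean_norm iterates_fejer // -ltnS prednK.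
Qed.

Hypothesis J_active : forall n, (1 <= n)%N -> J n \subset active (beta n).
Hypothesis nuJ_diverges : (\sum_(1 <= k <oo) (nuJ beta J nn k)%:E = +oo)%E.
Hypothesis J_cover : forall k, (1 <= k)%N ->
    forall i, exists2 n, (nn k.-1 < n <= nn k)%N & i \in J n.

(** Otherwise every block after [m] lowers the squared distance to [c] by [e ^+ 2] times its [nuJ],
    and divergence would make that square negative. The index [i0] ensures that each block contains
    a pair, so [nuJ] is a true minimum. *)
Lemma exists_good_block c (i0 : 'I_N) m (e : R) : (forall i, C i c) -> 0 < e ->
  exists k, [/\ (m < k)%N & forall n i, (nn k.-1 < n <= nn k)%N -> i \in J n ->
    norm2 (x n.-1 - proj (C i) (x n.-1)) < e].
Proof.
move=> Cc e0; apply: contrapT => /forallNP H.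
have nuJ0 k : (1 <= k)%N -> 0 <= nuJ beta J nn k.
  move=> k1; have [n kn iJ] := J_cover k1 i0.
  have [[n' [j [/andP[kn' _] _ ->]]] _] := nuJ_min beta kn iJ.
  by apply/nu_ge0/beta_weights; apply: leq_trans kn'.
pose D n := dot (x n - c) (x n - c).
have step k : (m < k)%N -> e ^+ 2 * nuJ beta J nn k <= D (nn k.-1) - D (nn k).
  move=> mk; apply: contrapT => eD; apply: (H k); split => // n i kn iJ.
  rewrite ltNge; apply/negP => ex; apply: eD.
  have n0 : (0 < n)%N by case/andP: kn => kn _; apply: leq_trans kn.
  have bi : 0 < beta n i.
    by have /fintype.subsetP/(_ i iJ) := J_active n0; rewrite inE.
  have := iterates_block_decrease Cc kn bi; rewrite -/(D _) -/(D _).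
  have : e ^+ 2 * nuJ beta J nn k <= nu (beta n) i *
      dot (x n.-1 - proj (C i) (x n.-1)) (x n.-1 - proj (C i) (x n.-1)).
    rewrite mulrC; apply: ler_pM.
    - by apply: nuJ0; apply: leq_trans mk.
    - exact: sqr_ge0.
    - by have [] := nuJ_min beta kn iJ.
    - rewrite -euclidean_norm_sqr.
      by rewrite ler_sqr ?nnegrE ?euclidean_norm_ge0 ?(ltW e0).
  by lra.
have sum l : e ^+ 2 * (\sum_(m.+1 <= k < m.+1 + l) nuJ beta J nn k) <=
    D (nn m) - D (nn (m + l)%N).
  elim: l => [|l IH]; first by rewrite !addn0 big_geq // mulr0 subrr.
  rewrite addnS big_nat_recr ?leq_addr //= mulrDr.
  have := step (m.+1 + l)%N; rewrite ltnS leq_addr addSn /= addnS => /(_ isT).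
  by lra.
have [l] := pinfty_series_unbounded m (D (nn m) / e ^+ 2) nuJ0 nuJ_diverges.
rewrite ltr_pdivrMr ?exprn_gt0 // mulrC => lt.
have := sum l; have : 0 <= D (nn (m + l)%N) by exact: dot_ge0.
by lra.
Qed.

Hypothesis nn_increasing : forall k, (nn k < nn k.+1)%N.
Hypothesis inactive_summable :
  (\sum_(1 <= n <oo) (inactive_weight n)%:E < +oo)%E.

Lemma cluster_point_in_intersection c p : (forall i, C i c) ->
  (forall (e : R) m, 0 < e -> exists k,
    [/\ (m < k)%N, norm2 (x (nn k.-1) - p) < e
      & forall n i, (nn k.-1 < n <= nn k)%N -> i \in J n ->
          norm2 (x n.-1 - proj (C i) (x n.-1)) < e]) ->
  forall i, C i p.
Proof.
move=> Cc xp i; apply: contrapT => Cip.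
(* A finite union of closed sets missing [p], hence at a positive distance [e] from [p]. *)
pose B := \bigcup_(j in [set j | ~ C j p]) C j.
have cB : closed B by apply: closed_bigcup => // *; exact: finite_finset.
have Bp : ~ B p by move=> [j].
have [e e0 Be] := closed_far cB Bp.
pose M := norm2 (x 0 - c) + 1.
have M0 : 0 < M by rewrite ltr_wpDl // euclidean_norm_ge0.
(* Start and drift cost a quarter of [e] each, so iterates stay within [e / 2] of [p]; a further
   quarter reaches the projection, still too close to [p] to lie in [B]. *)
have e2 : 0 < e / 2 / 2 by rewrite !divr_gt0.
have w0 n : (1 <= n)%N -> 0 <= inactive_weight n.
  by move=> n1; apply: sumr_ge0 => j _; have [] := beta_weights n1.
have [m tail] := nneg_series_small_tail w0 inactive_summable (divr_gt0 e2 M0).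
have [k [mk xk good]] := xp (e / 2 / 2) m e2.
have nn_ge l : (l <= nn l)%N by elim: l => // l /leq_ltn_trans; apply.
have near_p n j : (nn k.-1 < n <= nn k)%N -> j \in J n ->
    norm2 (x n.-1 - p) < e / 2 -> C j p.
  move=> kn jJ np; apply: contrapT => Cjp.
  have Bj : B (proj (C j) (x n.-1)).
    by exists j => //; have [] := proj_nearest (x n.-1) (@C_closed j) (Cc j).
  have := good _ _ kn jJ; have := Be _ Bj.
  have := euclidean_dist_triangle p (x n.-1) (proj (C j) (x n.-1)).
  by rewrite (euclidean_normB p (x n.-1)); lra.
set a := nn k.-1 in xk near_p *.
have stay_half n : (a <= n)%N -> norm2 (x n - p) <=
    norm2 (x a - p) + (\sum_(a.+1 <= l < n.+1) inactive_weight l) * M ->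
    norm2 (x n - p) < e / 2.
  move=> an; have := tail a n; rewrite an andbT.
  have ma : (m <= a)%N.
    by apply: leq_trans (nn_ge _); rewrite -ltnS prednK // (leq_trans _ mk).
  by move=> /(_ ma); rewrite ltr_pdivlMr //; lra.
(* Induction along the block: the bound keeps the iterate near [p], so the next [J] contains only
   indices whose sets contain [p], and the quasi-Fejer step extends the bound. *)
have stay t : (a + t <= nn k)%N -> norm2 (x (a + t)%N - p) <=
    norm2 (x a - p) + (\sum_(a.+1 <= l < (a + t).+1) inactive_weight l) * M.
  elim: t => [_|t IH]; first by rewrite addn0 big_geq // mul0r addr0.
  rewrite addnS => atk; have {}IH := IH (ltnW atk).
  have half := stay_half _ (leq_addr t a) IH.
  have := iterates_quasi_fejer (n := a + t) (p := p) Cc.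
  have /[swap] /[apply] : forall j, j \in J (a + t).+1 -> C j p.
    by move=> j jJ; apply: near_p jJ half; rewrite ltnS leq_addr.
  rewrite big_nat_recr /= ?ltnS ?leq_addr //.
  have : inactive_weight (a + t).+1 * norm2 (x 0 - c) <=
      inactive_weight (a + t).+1 * M.
    by rewrite ler_wpM2l ?w0 // lerDl.
  by lra.
have k0 : (0 < k)%N by apply: leq_trans mk.
have [n kn iJ] := J_cover k0 i.
apply: Cip; apply: (near_p _ _ kn iJ).
have /andP[an nk] := kn.
have an' : (a <= n.-1)%N by rewrite -ltnS prednK // (leq_trans _ an).
apply: stay_half => //; have := stay (n.-1 - a)%N; rewrite subnKC //.
by apply; apply: leq_trans (leq_pred n) nk.
Qed.

Lemma iterates_cvg (i0 : 'I_N) : \bigcap_i C i !=set0 ->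
  exists2 p, (\bigcap_i C i) p & x n @[n --> \oo] --> p.
Proof.
move=> [c Cc]; have {}Cc i : C i c by exact: Cc.
have Hk j : exists k, (j < k)%N /\ forall n i, (nn k.-1 < n <= nn k)%N ->
    i \in J n -> norm2 (x n.-1 - proj (C i) (x n.-1)) < j.+1%:R^-1.
  have j0 : (0 : R) < j.+1%:R^-1 by rewrite invr_gt0.
  by have [k [jk Pk]] := exists_good_block i0 j Cc j0; exists k.
have [kk kkP] := choice Hk.
have [j|p py] := @bounded_cluster _ _ (fun j => x (nn (kk j).-1)) c
  (norm2 (x 0 - c)).
  exact: iterates_fejer.
have Cp : forall i, C i p.
  apply: (cluster_point_in_intersection Cc) => e m e0.
  have [l _ lP] := near_infty_natSinv_lt (PosNum e0).
  (* [m] makes the block late enough, [l] makes the tolerance of the block smaller than [e]. *)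
  have [j mj jp] := py _ (maxn m l) e0.
  have [jk good] := kkP j; exists (kk j); split => //.
    by apply: leq_trans jk; rewrite ltnS (leq_trans (leq_maxl m l)).
  move=> n i kn iJ; apply: lt_trans (good _ _ kn iJ) _.
  by apply: lP; apply: leq_trans mj; exact: leq_maxr.
exists p; first by move=> i _; exact: Cp.
apply/cvgrPdist_lt => e e0.
(* A single block start within [e] of [p] suffices, since distances to [p] no longer increase. *)
have [j _ jp] := py _ 0%N e0.
exists (nn (kk j).-1) => // n /= jn.
rewrite distrC; apply: le_lt_trans (norm_le_euclidean_norm _) _.
exact: le_lt_trans (iterates_fejer Cp jn) jp.
Qed.

End Iteration.

Theorem corollary1 (R : realType) (d N : nat) (N_gt0 : (0 < N)%N)
  (C : 'I_N -> set 'rV[R]_d)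
  (C_closed : forall i, closed (C i))
  (C_convex : forall i, convex_set (C i))
  (C_nonempty : \bigcap_i C i !=set0)
  (beta : nat -> 'I_N -> R)
  (beta_weights : forall n, (1 <= n)%N -> weights (beta n))
  (J : nat -> {set 'I_N})
  (J_active : forall n, (1 <= n)%N -> J n \subset active (beta n))
  (inactive_summable :
    (\sum_(1 <= n <oo)
       (\sum_(i in active (beta n) :\: J n) beta n i)%:E < +oo)%E)
  (J_infinitely_often :
    forall i, infinite_set [set n | (1 <= n)%N /\ i \in J n])
  (nn : nat -> nat)
  (nn_increasing : forall k, (nn k < nn k.+1)%N)
  (J_cover : forall k, (1 <= k)%N ->
    forall i, exists2 n, (nn k.-1 < n <= nn k)%N & i \in J n)
  (nuJ_diverges : (\sum_(1 <= k <oo) (nuJ beta J nn k)%:E = +oo)%E)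
  (x : nat -> 'rV[R]_d)
  (x_rec : forall n, (1 <= n)%N -> x n = Q C (beta n) (x n.-1)) :
  exists2 p, (\bigcap_i C i) p & x n @[n --> \oo] --> p.
Proof.
exact: (iterates_cvg C_closed C_convex beta_weights x_rec J_active
  nuJ_diverges J_cover nn_increasing inactive_summable (Ordinal N_gt0)).
Qed.
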